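(* There exists a universal constant $\kappa$ such that the following holds. Let $n\ge1$, let $d\mu=e^{-V}dx$ be a probability measure on $\mathbb{R}^n$ satisfying a Poincaré inequality with constant $C_P$, and let $a\in\mathbb{R}^n$, $r>0$. Assume that one can find a sequence $V_k$ of smooth functions such that $d\mu_k=e^{-V_k}dx$ converges weakly to $\mu$ and $V_k$ converges uniformly to $V$ on $B(a,2r)$. Then for all $f\in C^1_b$ with $\int_{B(a,2r)}f\,d\mu=0$, $$\int f^2\,d\mu\ \le\ \left(\frac{32\,C_P}{\mu(B(a,r))}\left[1+2\,\frac{\kappa\,e^{\mathrm{Osc}_{B(a,2r)}V}}{n}\right]+2\,\frac{\kappa\,r^2\,e^{\mathrm{Osc}_{B(a,2r)}V}}{n}\right)\int|\nabla f|^2\,d\mu .$$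
   Context: $B(a,r)$ is the Euclidean ball of center $a$ and radius $r$. $\mathrm{Osc}_{B}V=\sup_BV-\inf_BV$. $\mu$ satisfies a Poincaré inequality with constant $C_P$ if $\mathrm{Var}_\mu(f)\le C_P\int|\nabla f|^2d\mu$ for all smooth $f$. $C_b^1$ denotes the bounded $C^1$ functions on $\mathbb{R}^n$ with bounded derivatives. *)

(* Defs.v *)
From HB Require Import structures.
From mathcomp Require Import all_boot all_order all_algebra.
From mathcomp Require Import all_classical all_reals all_analysis.
From mathcomp Require Import measurable_realfun.
Import Order.TTheory GRing.Theory Num.Theory.
Import numFieldNormedType.Exports.

Set Implicit Arguments.
Unset Strict Implicit.
Unset Printing Implicit Defensive.

Local Open Scope classical_set_scope.
Local Open Scope ring_scope.

(* R^n is 'rV[R]_n, equipped with its Borel sigma-algebra. *)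
Section borel.
Context (R : realType) (m n : nat).

Let borel : set (set 'M[R]_(m, n)) := <<s @open 'M[R]_(m, n) >>.

Let borel0 : borel set0. Proof. exact: sigma_algebra0. Qed.

Let borelC (A : set 'M[R]_(m, n)) : borel A -> borel (~` A).
Proof. exact: sigma_algebraC. Qed.

Let borel_bigcup (F : (set 'M[R]_(m, n))^nat) :
  (forall i, borel (F i)) -> borel (\bigcup_i F i).
Proof. exact: sigma_algebra_bigcup. Qed.

HB.instance Definition _ := @isMeasurable.Build
  (sigma_display (@open 'M[R]_(m, n))) 'M[R]_(m, n)
  borel borel0 borelC borel_bigcup.

End borel.

Section borel_theory.
Context (R : realType).

Lemma open_measurable_mx m n (A : set 'M[R]_(m, n)) : open A -> measurable A.
Proof. exact: sub_sigma_algebra. Qed.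

Lemma measurable_coord n (i : 'I_n) :
  measurable_fun setT (fun x : 'rV[R]_n => x ord0 i).
Proof.
apply: (measurability _ (RGenOInfty.measurableE R)).
move=> _ [_ [a ->] <-]; rewrite setTI; apply: open_measurable_mx.
apply: open_comp; last exact: interval_open.
by move=> x _; exact: coord_continuous.
Qed.

Let qball n (p : 'rV[rat]_n * nat) : set 'rV[R]_n :=
  [set x | forall i, `|x ord0 i - ratr (p.1 ord0 i)| < p.2.+1%:R^-1].

Let open_qball n (A : set 'rV[R]_n) : open A ->
  A = \bigcup_p (if `[< @qball n p `<=` A >] then @qball n p else set0).
Proof.
move=> oA; apply/seteqP; split=> [x Ax|x [p _]]; last first.
  by case: asboolP => // + qx; exact.
have /nbhs_ballP[_/posnumP[e] xeA] := open_nbhs_nbhs (conj oA Ax).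
have [k ke] : exists k, k.+1%:R^-1 < e%:num / 2.
  have [N _ /(_ N (leqnn N))] := near_infty_natSinv_lt (PosNum (divr_gt0 (gt0 e) (ltr0n R 2))).
  by exists N.
have /choice[q qP] : forall i, exists q : rat, `|x ord0 i - ratr q| < k.+1%:R^-1.
  move=> i; have : x ord0 i - k.+1%:R^-1 < x ord0 i by rewrite ltrBlDr ltrDl invr_gt0.
  move=> /rat_in_itvoo[q]; rewrite in_itv/= => /andP[q1 q2].
  by exists q; rewrite gtr0_norm ?subr_gt0// ltrBlDr -ltrBlDl.
exists (\row_i q i, k) => //; case: asboolP => [_ i|abs].
  by rewrite mxE.
exfalso; apply: abs => y /= yq; apply: xeA; split=> // i j.
rewrite ord1 /ball/= (@le_lt_trans _ _ (`|x ord0 j - ratr (q j)| + `|y ord0 j - ratr (q j)|))//.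
  by rewrite (distrC (y _ _)); exact: ler_distD.
have := yq j; rewrite mxE => yqj.
by rewrite [ltRHS](splitr) ltrD// (lt_trans _ ke).
Qed.

Lemma measurable_fun_rVP d (T : measurableType d) n (f : T -> 'rV[R]_n) :
  measurable_fun setT f <->
  forall i, measurable_fun setT (fun x => f x ord0 i).
Proof.
split=> [mf i|mf].
  exact: (measurableT_comp (measurable_coord i) mf).
apply: (measurability (@open 'rV[R]_n)) => //.
move=> _ [A oA <-]; rewrite setTI (open_qball oA) preimage_bigcup.
apply: countable_bigcupT_measurable; first exact: countableP.
move=> p; case: asboolP => _; last by rewrite preimage_set0.
rewrite (_ : _ @^-1` _ = \bigcap_(i in [set: 'I_n])
    (fun x => f x ord0 i) @^-1` ball (ratr (p.1 ord0 i) : R) p.2.+1%:R^-1).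
  apply: fin_bigcap_measurable => // i _.
  by rewrite -[X in measurable X]setTI; apply: mf => //; exact: measurable_ball.
by apply/seteqP; split=> x /= => [H i _|H i]; [|have := H i Logic.I];
  rewrite /ball/= distrC//; apply: H.
Qed.

End borel_theory.

(* The Lebesgue measure of R^n.+1 is the image of the product of the Lebesgue
   measures of R and R^n under (t, x) |-> (t, x_0, ..., x_{n-1}). *)
Section lebesgue_rV.
Context (R : realType).
Local Open Scope ereal_scope.

Definition consr n (p : R * 'rV[R]_n) : 'rV[R]_n.+1 :=
  \row_i oapp (fun j => p.2 ord0 j) p.1 (unlift ord0 i).

Lemma measurable_consr n : measurable_fun setT (@consr n).
Proof.
apply/measurable_fun_rVP => i.
case: (unliftP ord0 i) => [j ->|->].
- rewrite (_ : (fun _ => _) = (fun v : 'rV[R]_n => v ord0 j) \o snd).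
    by apply: measurableT_comp => //; exact: measurable_coord.
  by apply/funext => p; rewrite mxE liftK.
- rewrite (_ : (fun _ => _) = fst) //.
  by apply/funext => p; rewrite mxE unlift_none.
Qed.

Section step.
Context n (mu : {sigma_finite_measure set 'rV[R]_n -> \bar R}).

Definition leb_step : set 'rV[R]_n.+1 -> \bar R :=
  pushforward (@lebesgue_measure R \x mu) (@consr n).

Let leb_step0 : leb_step set0 = 0.
Proof. by rewrite /leb_step /pushforward preimage_set0 measure0. Qed.

Let leb_step_ge0 A : 0 <= leb_step A.
Proof. by rewrite /leb_step /pushforward; exact: measure_ge0. Qed.

Let leb_step_sigma_additive : semi_sigma_additive leb_step.
Proof.
move=> F mF tF mUF.
have mc A : measurable A -> measurable (@consr n @^-1` A).
  by move=> mA; rewrite -[X in measurable X]setTI; exact: measurable_consr.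
rewrite /leb_step /pushforward preimage_bigcup.
apply: measure_semi_sigma_additive => [k||].
- exact: mc.
- apply/trivIsetP => i j _ _ ij; rewrite -preimage_setI.
  by move/trivIsetP : tF => ->//; rewrite preimage_set0.
- by rewrite -preimage_bigcup; exact: mc.
Qed.

HB.instance Definition _ := isMeasure.Build _ _ _ leb_step
  leb_step0 leb_step_ge0 leb_step_sigma_additive.

Let leb_step_sigma_finite : sigma_finite setT leb_step.
Proof.
have /sigma_finiteP[F [TF ndF Foo]] := sigma_finiteT (@lebesgue_measure R).
have /sigma_finiteP[G [TG ndG Goo]] := sigma_finiteT mu.
pose u := fun v : 'rV[R]_n.+1 => (v ord0 ord0, \row_j v ord0 (lift ord0 j)).
have mu_ : measurable_fun setT u.
  apply: measurable_fun_pair; first exact: measurable_coord.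
  apply/measurable_fun_rVP => i.
  rewrite (_ : (fun _ => _) = fun v : 'rV[R]_n.+1 => v ord0 (lift ord0 i)).
    exact: measurable_coord.
  by apply/funext => v; rewrite mxE.
have uK p : u (consr p) = p.
  case: p => x v; congr pair; first by rewrite mxE unlift_none.
  by apply/rowP => j; rewrite !mxE liftK.
exists (fun k => u @^-1` (F k `*` G k)).
  rewrite -preimage_bigcup (_ : \bigcup_i _ = setT) ?preimage_setT//.
  apply/seteqP; split=> // -[x y] _.
  have [i _ Fix] : (\bigcup_i F i) x by rewrite -TF.
  have [j _ Gjy] : (\bigcup_j G j) y by rewrite -TG.
  exists (maxn i j) => //; split.
  - by move: x Fix; exact/subsetPset/ndF/leq_maxl.
  - by move: y Gjy; exact/subsetPset/ndG/leq_maxr.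
move=> k; have [mF Fk] := Foo k; have [mG Gk] := Goo k; split.
  by rewrite -[X in measurable X]setTI; apply: mu_ => //; exact: measurableX.
rewrite /leb_step /pushforward -comp_preimage.
rewrite (_ : u \o _ = id); last by apply/funext => p /=.
by rewrite preimage_id product_measure1E// lte_mul_pinfty// ge0_fin_numE.
Qed.

HB.instance Definition _ := Measure_isSigmaFinite.Build _ _ _ leb_step
  leb_step_sigma_finite.

End step.

Fixpoint lebesgue_rV n : {sigma_finite_measure set 'rV[R]_n -> \bar R} :=
  match n with
  | 0 => \d_(0%R : 'rV[R]_0)
  | m.+1 => leb_step (lebesgue_rV m)
  end.

Lemma lebesgue_rV_box n (a b : 'I_n -> R) : (forall i, a i <= b i)%R ->
  lebesgue_rV n [set x | forall i, (a i <= x ord0 i <= b i)%R] =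
  (\prod_(i < n) (b i - a i))%:E.
Proof.
elim: n a b => [|n IH] a b ab.
  rewrite big_ord0 /= diracE mem_set// => -[] //.
rewrite big_ord_recl EFinM.
pose B := [set x : 'rV[R]_n |
  forall i, (a (lift ord0 i) <= x ord0 i <= b (lift ord0 i))%R].
transitivity ((@lebesgue_measure R \x lebesgue_rV n) (`[a ord0, b ord0]%classic `*` B)).
  congr (product_measure1 _ _ _).
  apply/seteqP; split=> [[x v]/= H|[x v]/= [H0 H] i].
    split; first by have := H ord0; rewrite mxE unlift_none in_itv.
    by move=> i; have := H (lift ord0 i); rewrite mxE liftK.
  by case: (unliftP ord0 i) => [j ->|->]; rewrite mxE ?liftK ?unlift_none //=.
have mB : measurable B.
  rewrite (_ : B = \bigcap_(i in [set: 'I_n])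
    ((fun x : 'rV[R]_n => x ord0 i) @^-1` `[a (lift ord0 i), b (lift ord0 i)])).
    apply: fin_bigcap_measurable => // i _.
    by rewrite -[X in measurable X]setTI; exact: measurable_coord.
  by apply/seteqP; split=> x /= H i => [_|]; have := H i;
    rewrite /= in_itv/= => // /(_ Logic.I).
rewrite product_measure1E//; congr (_ * _); last exact: IH.
apply: etrans (lebesgue_measure_itv _) _; rewrite /= lte_fin.
have := ab ord0; rewrite le_eqVlt => /predU1P[->|->//].
by rewrite ltxx subrr.
Qed.

End lebesgue_rV.

Section euclidean.
Context (R : realType) (n : nat).

(* The norm `|x| of 'rV[R]_n is the sup norm, hence this explicit Euclidean
   (squared) norm. *)
Definition sqnorm (x : 'rV[R]_n) : R := \sum_(i < n) x ord0 i ^+ 2.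

Definition eball (a : 'rV[R]_n) (r : R) : set 'rV[R]_n :=
  [set x | Num.sqrt (sqnorm (x - a)) < r].

Definition partial (i : 'I_n) (f : 'rV[R]_n -> R) : 'rV[R]_n -> R :=
  'D_(delta_mx ord0 i) f.

Definition grad (f : 'rV[R]_n -> R) (x : 'rV[R]_n) : 'rV[R]_n :=
  \row_i partial i f x.

Fixpoint Ck (k : nat) (f : 'rV[R]_n -> R) : Prop :=
  match k with
  | 0 => continuous f
  | k'.+1 => continuous f /\
      forall i, (forall x, derivable f x (delta_mx ord0 i)) /\
                Ck k' (partial i f)
  end.

Definition smooth (f : 'rV[R]_n -> R) : Prop := forall k, Ck k f.

Definition Cb1 (f : 'rV[R]_n -> R) : Prop :=
  [/\ Ck 1 f, bounded_fun f & forall i, bounded_fun (partial i f)].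

End euclidean.

Section measures.
Context (R : realType) (n : nat).
Local Open Scope ereal_scope.

(* d mu = e^{-V} dx; the value V x = +oo stands for a vanishing density. *)
Definition has_potential (mu : set 'rV[R]_n -> \bar R)
    (V : 'rV[R]_n -> \bar R) : Prop :=
  measurable_fun setT V /\
  forall A, measurable A -> mu A = \int[lebesgue_rV R n]_(x in A) expeR (- V x).

Definition weak_cvg (muk : nat -> {measure set 'rV[R]_n -> \bar R})
    (mu : {measure set 'rV[R]_n -> \bar R}) : Prop :=
  forall g : 'rV[R]_n -> R, continuous g -> bounded_fun g ->
    (fun k => \int[muk k]_x (g x)%:E) @ \oo --> \int[mu]_x (g x)%:E.

(* 'V_mu[f] is +oo for a measurable f that is not square integrable. *)
Definition poincare (mu : probability 'rV[R]_n R) (CP : R) : Prop :=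
  forall f : 'rV[R]_n -> R, smooth f ->
    'V_mu[f] <= CP%:E * \int[mu]_x (sqnorm (grad f x))%:E.

(* The bound forces V to be finite on B. *)
Definition unif_cvg_on (B : set 'rV[R]_n) (Vk : nat -> 'rV[R]_n -> R)
    (V : 'rV[R]_n -> \bar R) : Prop :=
  forall eps : R, (0 < eps)%R -> \forall k \near \oo,
    forall x, B x -> `|(Vk k x)%:E - V x| <= eps%:E.

Definition osc (B : set 'rV[R]_n) (V : 'rV[R]_n -> \bar R) : \bar R :=
  ereal_sup [set V x | x in B] - ereal_inf [set V x | x in B].

End measures.

(* Main.v *)
Require Import Defs.
From HB Require Import structures.
From mathcomp Require Import all_boot all_order all_algebra.
From mathcomp Require Import all_classical all_reals all_analysis.
From mathcomp Require Import measurable_realfun ring lra.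
Import Order.TTheory GRing.Theory Num.Theory.
Import numFieldNormedType.Exports.

Local Open Scope classical_set_scope.
Local Open Scope ring_scope.

(** The additive constant kappa = 0 will do, because the constraint on f over
the ball B = B(a, 2r) already controls the global mean m of f.  Let 1_B' be the
indicator of the complement of B.  As f integrates to 0 over B,
  0 <= int (f - m 1_B')^2 dmu = int f^2 dmu - m^2 - m^2 mu(B),
so m^2 mu(B) <= Var(f), whence
  int f^2 dmu = Var(f) + m^2 <= (1 + 1 / mu(B)) Var(f) <= 2 / mu(B) Var(f)
([second_moment_le_variance]).  The Poincare inequality bounds Var(f) by
CP int |grad f|^2 dmu, and 2 / mu(B(a, 2r)) is below 32 / mu(B(a, r)).
The ball B(a, r) is charged because uniform approximation by finite functions
makes V finite on it, so that the density is positive there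
([density_eball_gt0]).

The real work is that the Poincare inequality is assumed for smooth functions
only, whereas f is merely C^1 with bounded derivatives; it is extended to such f
in [poincare_Cb1].  The approximation avoids convolution and rests on finite
sums.  On the unit cube, f is approximated in the C^1 norm by polynomials:
Bernstein operators are applied in one coordinate after the other
([polynomial_C1_dense]).  The coordinatewise change of variables
t |-> (1 + sin (w t)) / 2 maps the whole space into the cube and turns
polynomials into smooth bounded functions; composed with the affine map from the
cube to [-1/w, 1/w]^n it becomes t |-> sin (w t) / w, which tends to t as w
tends to 0.  The resulting smooth functions converge to f pointwise together
with their gradients, under uniform bounds ([smooth_approximation]), and
dominated convergence passes to the limit in the inequality. *)

(** * Coordinates and partial derivatives *)

Section coordinates.
Context {R : realType} {n : nat}.
Implicit Types (x y : 'rV[R]_n) (i j : 'I_n) (f g : 'rV[R]_n -> R).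

(** Written as a translation so that continuity in x and the comparison with
difference quotients along basis vectors are immediate. *)
Definition upd x i (t : R) : 'rV[R]_n :=
  x + (t - x ord0 i) *: delta_mx ord0 i.

Lemma updE x i t j : upd x i t ord0 j = if j == i then t else x ord0 j.
Proof.
by rewrite !mxE /=; case: eqP => [->|_] /=; rewrite ?mulr1 ?mulr0 ?addr0// subrKC.
Qed.

Lemma upd_id x i : upd x i (x ord0 i) = x.
Proof. by rewrite /upd subrr scale0r addr0. Qed.

Lemma upd_upd x i s t : upd (upd x i s) i t = upd x i t.
Proof. by apply/rowP => j; rewrite !updE; case: eqP. Qed.

Lemma shift_upd x i (h : R) :
  h *: delta_mx ord0 i + x = upd x i (h + x ord0 i).
Proof. by rewrite /upd addrK addrC. Qed.

Lemma continuous_upd i t : continuous (fun x => upd x i t).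
Proof.
move=> x; have cB : {for x, continuous (fun y : 'rV[R]_n => t - y ord0 i)}.
  by apply: continuousB; [exact: cst_continuous|exact: coord_continuous].
have cZ := @continuousZr_tmp R 'rV[R]_n 'rV[R]_n _ (delta_mx ord0 i) x cB.
by apply: (@continuousD _ 'rV[R]_n 'rV[R]_n (fun y => y)) cZ; exact.
Qed.

Lemma continuous_add f g :
  continuous f -> continuous g -> continuous (fun x => f x + g x).
Proof. by move=> cf cg x; apply: continuousD; [exact: cf|exact: cg]. Qed.

Lemma continuous_mul f g :
  continuous f -> continuous g -> continuous (fun x => f x * g x).
Proof. by move=> cf cg x; apply: continuousM; [exact: cf|exact: cg]. Qed.

(** The two difference quotients are the same function, so every question about
partial derivatives reduces to one real variable. *)
Lemma is_derive_upd f x i (d : R) :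
  is_derive x (delta_mx ord0 i) f d <->
  is_derive (x ord0 i) 1 (fun t => f (upd x i t)) d.
Proof.
have E : (fun h : R => h^-1 *: ((f \o shift x) (h *: delta_mx ord0 i) - f x)) =
    (fun h : R => h^-1 *: (((fun t => f (upd x i t)) \o shift (x ord0 i)) (h *: 1)
      - f (upd x i (x ord0 i)))).
  by apply/funext => h /=; rewrite shift_upd upd_id /GRing.scale /= mulr1.
by split=> -[]; rewrite /derivable /derive => ? <-; split;
  rewrite /derivable /derive ?E// -E.
Qed.

Lemma partialE {f x i} {d : R} :
  is_derive x (delta_mx ord0 i) f d -> partial i f x = d.
Proof. by move=> H; exact: derive_val. Qed.

Lemma CkW k f : Ck k.+1 f -> Ck k f.
Proof.
elim: k f => [|k IH] f; first by case.
by move=> [cf df]; split=> // i; have [dfi kf] := df i; split=> //; exact: IH.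
Qed.

Lemma Ck_step k f (df : 'I_n -> 'rV[R]_n -> R) : continuous f ->
  (forall i x, is_derive x (delta_mx ord0 i) f (df i x)) ->
  (forall i, Ck k (df i)) -> Ck k.+1 f.
Proof.
move=> cf dfE cdf; split=> // i; split=> [x|].
  exact: (@ex_derive _ _ _ _ _ _ _ (dfE i x)).
rewrite (_ : partial i f = df i) //.
by apply/funext => x; exact: (partialE (dfE i x)).
Qed.

Lemma Ck_continuous k f : Ck k f -> continuous f.
Proof. by case: k => [|k] // []. Qed.

Lemma Ck_is_derive k f i x : Ck k.+1 f ->
  is_derive x (delta_mx ord0 i) f (partial i f x).
Proof. by move=> [_ /(_ i) [df _]]; exact/derivableP. Qed.

Lemma Ck1_is_derive_upd f i x (t : R) : Ck 1 f ->
  is_derive t 1 (fun s => f (upd x i s)) (partial i f (upd x i t)).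
Proof.
move=> f1; have /is_derive_upd := Ck_is_derive 0 f i (upd x i t) f1.
rewrite updE eqxx; congr is_derive.
by apply/funext => s; rewrite upd_upd.
Qed.

Definition coordwise (s : R -> R) x : 'rV[R]_n := \row_i s (x ord0 i).

Lemma coordwise_upd s x i t :
  coordwise s (upd x i t) = upd (coordwise s x) i (s t).
Proof. by apply/rowP => j; rewrite mxE !updE mxE; case: eqP. Qed.

Lemma is_derive_coordwise f (s : R -> R) (ds : R) i x : Ck 1 f ->
  is_derive (x ord0 i) 1 s ds ->
  is_derive x (delta_mx ord0 i) (f \o coordwise s)
    (partial i f (coordwise s x) * ds).
Proof.
move=> f1 sx; apply/is_derive_upd.
rewrite (_ : (fun _ => _) = (fun t => f (upd (coordwise s x) i t)) \o s); last first.
  by apply/funext => t /=; rewrite coordwise_upd.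
apply: is_derive1_comp.
have := Ck1_is_derive_upd f i (coordwise s x) (s (x ord0 i)) f1.
by rewrite -coordwise_upd upd_id.
Qed.

End coordinates.

(** * Bernstein operators on sequences *)

Section bernstein.
Context {R : realType}.
Implicit Types (c d : nat -> R) (t : R).

(** The de Casteljau recursion for the Bernstein polynomial
sum_k C(N, k) t^k (1 - t)^(N - k) c_k, that is, the mean of c at a binomial
variable with parameters N and t.  Conditioning on the first trial makes moments
and derivatives plain inductions, without binomial coefficients. *)
Fixpoint bern (N : nat) c t : R :=
  if N is N'.+1 then (1 - t) * bern N' c t + t * bern N' (c \o S) t else c 0%N.

Lemma eq_bern N c d t : c =1 d -> bern N c t = bern N d t.
Proof. by move=> /funext ->. Qed.

Lemma bern_cst N (a : R) t : bern N (fun=> a) t = a.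
Proof. by elim: N => //= N IH; rewrite IH -mulrDl subrK mul1r. Qed.

Lemma bern_lin N (a b : R) c d t :
  bern N (fun k => a * c k + b * d k) t = a * bern N c t + b * bern N d t.
Proof. elim: N c d => //= N IH c d; rewrite IH (IH (c \o S) (d \o S)); ring. Qed.

Lemma bernB N c d t : bern N (fun k => c k - d k) t = bern N c t - bern N d t.
Proof.
rewrite -[in RHS](mul1r (bern N c t)) -mulN1r -bern_lin.
by apply: eq_bern => k; rewrite mul1r mulN1r.
Qed.

(** The second moment about s of a binomial variable: squared bias plus
variance. *)
Lemma bern_var N (s : R) t :
  bern N (fun k => (k%:R - s) ^+ 2) t = (N%:R * t - s) ^+ 2 + N%:R * t * (1 - t).
Proof.
elim: N s => [|N IH] s /=; first by ring.
rewrite IH (eq_bern _ _ (fun k : nat => (k%:R - (s - 1)) ^+ 2)).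
  by rewrite IH -natr1; ring.
by move=> k /=; rewrite -natr1; congr (_ ^+ 2); ring.
Qed.

Lemma le_bern N c d t : 0 <= t <= 1 -> (forall k, (k <= N)%N -> c k <= d k) ->
  bern N c t <= bern N d t.
Proof.
move=> /andP[t0 t1]; elim: N c d => [|N IH] c d cd /=; first exact: cd.
apply: lerD; apply: ler_wpM2l; rewrite ?subr_ge0//; apply: IH => k kN.
  by apply: cd; rewrite (leq_trans kN).
exact: cd.
Qed.

Lemma norm_bern N c d t : 0 <= t <= 1 ->
  (forall k, (k <= N)%N -> `|c k| <= d k) -> `|bern N c t| <= bern N d t.
Proof.
move=> t01 cd; rewrite ler_norml; apply/andP; split; last first.
  by apply: le_bern => // k /cd; apply: le_trans; exact: ler_norm.
rewrite -[leLHS]add0r -(bern_cst N 0 t) -bernB; apply: le_bern => // k /cd.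
by rewrite sub0r ler_norml => /andP[].
Qed.

(** Bernstein's proof of the Weierstrass theorem, by Chebyshev's argument: far
from t the error is at most 2 C <= 2 C (s - t)^2 / delta^2, and this quadratic
term has mean of order 1 / N.  The samples may be taken at any points xi k
within 1 / N of the nodes k / N, because the derivative of a Bernstein polynomial
has difference quotients for coefficients: these are values of the derivative at
points that the mean value theorem provides. *)
Lemma bern_near (psi : R -> R) (C delta eps : R) N c (xi : nat -> R) t :
  0 < delta -> 0 <= C -> (0 < N)%N -> 0 <= t <= 1 -> 0 <= eps ->
  (forall s, 0 <= s <= 1 -> `|psi s| <= C) ->
  (forall s, 0 <= s <= 1 -> `|s - t| < delta -> `|psi s - psi t| <= eps) ->
  (forall k, (k <= N)%N -> [/\ 0 <= xi k <= 1,
     `|xi k - k%:R / N%:R| <= N%:R^-1 & c k = psi (xi k)]) ->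
  `|bern N c t - psi t| <= eps + 8 * C / delta ^+ 2 / N%:R.
Proof.
move=> d0 C0 N0 t01 e0 psiC psid cE.
have N0' : 0 < N%:R :> R by rewrite ltr0n.
(* comes from (xi k - t)^2 <= 2 (k / N - t)^2 + 2 / N^2 *)
pose K := 4 * C / delta ^+ 2 / N%:R ^+ 2.
have A0 : 0 <= 2 * C / delta ^+ 2.
  by apply: mulr_ge0; rewrite ?invr_ge0 ?sqr_ge0// mulr_ge0.
have K0 : 0 <= K.
  apply: mulr_ge0; rewrite ?invr_ge0 ?sqr_ge0//.
  by apply: mulr_ge0; rewrite ?invr_ge0 ?sqr_ge0// mulr_ge0.
rewrite -[X in _ - X](bern_cst N _ t) -bernB.
apply: (@le_trans _ _ (bern N
    (fun k => (eps + K) * 1 + K * (k%:R - N%:R * t) ^+ 2) t)).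
  apply: norm_bern => // k /cE[xi01 xik ->].
  apply: (@le_trans _ _ (eps + 2 * C / delta ^+ 2 * (xi k - t) ^+ 2)).
    have [near_t|far] := ltP `|xi k - t| delta.
      apply: le_trans (psid _ xi01 near_t) _.
      by rewrite lerDl mulr_ge0// sqr_ge0.
    apply: (@le_trans _ _ (2 * C)).
      apply: le_trans (ler_normB _ _) _.
      by have := psiC _ xi01; have := psiC _ t01; lra.
    apply: (@le_trans _ _ (2 * C / delta ^+ 2 * delta ^+ 2)).
      by rewrite divfK// expf_neq0// gt_eqF.
    rewrite -[leLHS]add0r; apply: lerD => //; apply: ler_wpM2l => //.
    by rewrite -(real_normK (num_real (xi k - t))) ler_sqr ?nnegrE// ltW.
  have -> : (eps + K) * 1 + K * (k%:R - N%:R * t) ^+ 2 =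
      eps + 2 * C / delta ^+ 2 * (2 * (k%:R / N%:R - t) ^+ 2 + 2 * N%:R^-1 ^+ 2).
    by rewrite /K; field; rewrite !gt_eqF.
  rewrite lerD2l; apply: ler_wpM2l => //.
  have : (xi k - k%:R / N%:R) ^+ 2 <= N%:R^-1 ^+ 2.
    by rewrite -(real_normK (num_real (xi k - _))) ler_sqr ?nnegrE// invr_ge0 ltW.
  set u := xi k - k%:R / N%:R; set w := N%:R^-1 ^+ 2; move=> uw.
  have -> : xi k - t = u + (k%:R / N%:R - t) by rewrite /u addrA subrK.
  set v := _ / _ - t; have := sqr_ge0 (u - v); nra.
rewrite bern_lin bern_cst bern_var subrr expr0n /= add0r mulr1 -addrA lerD2l.
have -> : 8 * C / delta ^+ 2 / N%:R = K * (2 * N%:R).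
  by rewrite /K; field; rewrite !gt_eqF.
rewrite -[X in X + _]mulr1 -mulrDr ler_wpM2l//.
have N1 : 1 <= N%:R :> R by rewrite ler1n.
move: t01 => /andP[t0 t1]; have := mulr_ge0 t0 (ltW N0'); nra.
Qed.

Definition fdiff c : nat -> R := fun k => c k.+1 - c k.

Context {n : nat}.

(** Both the coefficients and the point may depend on the variable; the first
term comes from the coefficients, the second is the classical formula expressing
the derivative of a Bernstein polynomial by the one of lower degree built on
forward differences. *)
Lemma is_derive_bern N (c : nat -> 'rV[R]_n -> R) dc (u : 'rV[R]_n -> R) du
    (x v : 'rV[R]_n) :
  (forall k, is_derive x v (c k) (dc k : R)) -> is_derive x v u (du : R) ->
  is_derive x v (fun y => bern N (c ^~ y) (u y))
    (bern N dc (u x) + du * (N%:R * bern N.-1 (fdiff (c ^~ x)) (u x))).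
Proof.
move=> cdc udu; elim: N c dc cdc => [|N IH] c dc cdc /=.
  by apply: is_derive_eq (cdc 0%N) _; ring.
have /= H1 := IH _ _ cdc; have /= H2 := IH (c \o S) (dc \o S) (fun k => cdc k.+1).
have H := is_deriveD (is_deriveM (is_deriveB (is_derive_cst (1 : R) x v) udu) H1)
  (is_deriveM udu H2).
apply: (is_derive_eq H).
rewrite /GRing.scale /=.
rewrite (_ : (_ - _) x = 1 - u x)//.
have -> : bern N (fdiff (c^~ x)) (u x) =
    bern N ((c ^~ x) \o S) (u x) - bern N (c ^~ x) (u x) by rewrite -bernB.
case: N {IH H H1 H2} => [|N] /=; first by ring.
have -> : bern N (fdiff (c^~ x)) (u x) =
    bern N ((c ^~ x) \o S) (u x) - bern N (c ^~ x) (u x) by rewrite -bernB.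
have -> : bern N (fdiff (fun k => c k.+1 x)) (u x) =
    bern N ((fun k => c k.+1 x) \o S) (u x) - bern N (fun k => c k.+1 x) (u x).
  by rewrite -bernB.
rewrite -!natr1 /=.
have -> : bern N (fun x0 : nat => (c \o S) x0 x) (u x)
   = bern N (fun k => c k.+1 x) (u x) by [].
ring.
Qed.

Lemma continuous_bern N (c : nat -> 'rV[R]_n -> R) (u : 'rV[R]_n -> R) :
  (forall k, continuous (c k)) -> continuous u ->
  continuous (fun y => bern N (c ^~ y) (u y)).
Proof.
move=> cc cu; elim: N c cc => [|N IH] c cc /=; first exact: cc.
apply: continuous_add; apply: continuous_mul; [|exact: IH|exact: cu|].
  by move=> x; apply: continuousB; [exact: cst_continuous|exact: cu].
exact: (IH (c \o S) (fun k => cc k.+1)).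
Qed.

End bernstein.

(** * Polynomials are dense in C^1 of the unit cube *)

Section cube_approximation.
Context {R : realType} {n : nat}.
Implicit Types (x y : 'rV[R]_n) (i j : 'I_n) (f g : 'rV[R]_n -> R).

(** The Heine-Cantor theorem, with y allowed to leave K. *)
Lemma compact_modulus (K : set 'rV[R]_n) g (eps : R) :
  compact K -> continuous g -> 0 < eps ->
  exists2 delta : R, 0 < delta &
    forall x y, K x -> ball x delta y -> `|g y - g x| <= eps.
Proof.
move=> /compact_near_coveringP cK cg e0.
have e20 : 0 < eps / 2 by rewrite divr_gt0.
have near_g x : \forall x' \near x, `|g x' - g x| < eps / 2.
  have /cvgrPdist_lt/(_ _ e20) := cg x.
  by apply: filterS => y; rewrite distrC.
have := cK R 0^'+ (fun d x => forall y, ball x d y -> `|g y - g x| <= eps) _ _.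
case=> [x Kx|d [/= d0 dP]].
- have /nbhs_ballP[d /= d0 dP] := near_g x.
  have d20 : 0 < d / 2 by rewrite divr_gt0.
  exists (ball x (d / 2), [set t | t < d / 2]) => /=.
    by split; [exact: nbhsx_ballx|exact: nbhs_right_lt].
  move=> [x' t] /= [xx' td] y x'y.
  have xy : ball x d y.
    by rewrite [d]splitr; apply: ball_triangle xx' _; exact: le_ball (ltW td) _ x'y.
  have xx'd : ball x d x'.
    by apply: le_ball xx'; rewrite ler_pdivrMr// ler_pMr// ler1n.
  have := dP _ xy; have := dP _ xx'd => /=; rewrite (distrC (g x')).
  move=> /ltW h1 /ltW h2; apply: le_trans (ler_distD (g x) _ _) _.
  by rewrite [leRHS]splitr; exact: lerD.
- exists (d / 2); first by rewrite divr_gt0.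
  move=> x y Kx; apply: (dP (d / 2)) => //=; last by rewrite divr_gt0.
  rewrite sub0r normrN gtr0_norm ?divr_gt0//.
  by rewrite ltr_pdivrMr// ltr_pMr// ltr1n.
Qed.

Lemma compact_norm_bound (K : set 'rV[R]_n) g : compact K -> continuous g ->
  exists2 C : R, 0 <= C & forall x, K x -> `|g x| <= C.
Proof.
move=> cK cg.
have /compact_bounded[M [_ gM]] : compact (g @` K).
  by apply: continuous_compact => //; exact: continuous_subspaceT.
have M1 : M < `|M| + 1 by rewrite (le_lt_trans (ler_norm _))// ltrDl.
exists (`|M| + 1) => [|x Kx]; first by rewrite addr_ge0.
exact: (gM _ M1 (g x) (ex_intro2 _ _ x Kx erefl)).
Qed.

Definition cube : set 'rV[R]_n := [set x | forall i, 0 <= x ord0 i <= 1].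

Lemma compact_cube : compact cube.
Proof.
have -> : cube = [set x | forall i, `[0, 1]%classic (x ord0 i)].
  by apply/seteqP; split=> x /= xc i; have := xc i; rewrite /= in_itv.
exact: (@rV_compact R n (fun=> `[0, 1]%classic) (fun=> @segment_compact R 0 1)).
Qed.

Lemma cube_upd x i (t : R) : cube x -> 0 <= t <= 1 -> cube (upd x i t).
Proof. by move=> xc t01 j; rewrite updE; case: eqP. Qed.

(** The threshold N0 is uniform in x and in the sample points.  These may depend
on x, as they do for the points given by the mean value theorem. *)
Lemma bern_sample g i (eps : R) : continuous g -> 0 < eps ->
  exists N0 : nat, forall N x (c xi : nat -> R), (N0 < N)%N -> cube x ->
    (forall k, (k <= N)%N -> [/\ 0 <= xi k <= 1,
       `|xi k - k%:R / N%:R| <= N%:R^-1 & c k = g (upd x i (xi k))]) ->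
    `|bern N c (x ord0 i) - g x| <= eps.
Proof.
move=> cg e0.
have e20 : 0 < eps / 2 by rewrite divr_gt0.
have [d d0 gd] := compact_modulus _ _ _ compact_cube cg e20.
have [C C0 gC] := compact_norm_bound _ _ compact_cube cg.
pose A := 8 * C / d ^+ 2 / (eps / 2).
have A0 : 0 <= A.
  by rewrite divr_ge0 ?(ltW e20)// divr_ge0 ?sqr_ge0// mulr_ge0.
exists (Num.bound A) => N x c xi NA xc cE.
have N0 : (0 < N)%N by case: N NA {cE}.
have := bern_near (fun s => g (upd x i s)) C d (eps / 2) N c xi (x ord0 i)
  d0 C0 N0 (xc i) (ltW e20) _ _ cE.
rewrite upd_id => /(_ _ _)/le_trans; apply.
- by move=> s s01; apply: gC; exact: cube_upd.
- move=> s s01 sx; apply: gd => //; split=> // k j.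
  rewrite ord1 updE /ball /=; case: eqP => [->|_]; first by rewrite distrC.
  by rewrite subrr normr0.
rewrite [leRHS]splitr lerD2l ler_pdivrMr ?ltr0n// [leRHS]mulrC -ler_pdivrMr//.
apply/ltW/(lt_trans (archi_boundP A0)).
by rewrite ltr_nat.
Qed.

(** The Bernstein operator in the i-th coordinate, the others being frozen. *)
Definition bernop i (N : nat) g x : R :=
  bern N (fun k => g (upd x i (k%:R / N%:R))) (x ord0 i).

Lemma node01 (N k : nat) : (k <= N)%N -> 0 <= (k%:R / N%:R : R) <= 1.
Proof.
case: N => [|N] kN; first by rewrite invr0 mulr0 lexx ler01.
by rewrite divr_ge0//= ler_pdivrMr ?ltr0n// mul1r ler_nat.
Qed.

Lemma is_derive_updC g i j x (s : R) : Ck 1 g -> j != i ->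
  is_derive x (delta_mx ord0 j) (fun y => g (upd y i s)) (partial j g (upd x i s)).
Proof.
move=> g1 ji; apply/is_derive_upd.
have := Ck1_is_derive_upd g j (upd x i s) (x ord0 j) g1.
rewrite (_ : upd (upd x i s) j _ = upd x i s); last first.
  by apply/rowP => k; rewrite !updE; case: eqP => // ->; rewrite (negPf ji).
congr is_derive; apply/funext => t; congr g; apply/rowP => k; rewrite !updE.
by case: eqP => // ->; rewrite eq_sym; case: eqP => // E; rewrite E eqxx in ji.
Qed.

Lemma is_derive_coord i j x :
  is_derive x (delta_mx ord0 j) (fun y => y ord0 i) ((i == j)%:R : R).
Proof.
apply/is_derive_upd; under eq_fun do rewrite updE.
by case: eqP => _; [exact: is_derive_id|exact: is_derive_cst].
Qed.

(** In the other directions the operator commutes with differentiation; in its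
own direction the derivative is a Bernstein polynomial of difference quotients. *)
Lemma bernop_derive i N g j x : Ck 1 g ->
  is_derive x (delta_mx ord0 j) (bernop i N g)
    (if j == i then
       N%:R * bern N.-1 (fdiff (fun k => g (upd x i (k%:R / N%:R)))) (x ord0 i)
     else bernop i N (partial j g) x).
Proof.
move=> g1.
have du := is_derive_coord i j x.
have [ji|ji] := eqVneq j i.
  have dc k : is_derive x (delta_mx ord0 j) (fun y => g (upd y i (k%:R / N%:R))) 0.
    apply/is_derive_upd; rewrite ji; under eq_fun do rewrite upd_upd.
    exact: is_derive_cst.
  apply: is_derive_eq (is_derive_bern N _ _ _ _ _ _ dc du) _.
  by rewrite ji eqxx mul1r bern_cst add0r.
have dc k := is_derive_updC g i j x (k%:R / N%:R) g1 ji.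
apply: is_derive_eq (is_derive_bern N _ _ _ _ _ _ dc du) _.
by rewrite eq_sym (negPf ji) mul0r addr0.
Qed.

Lemma continuous_updr g i (s : R) : continuous g -> continuous (fun x => g (upd x i s)).
Proof.
move=> cg x; apply: (@continuous_comp _ _ _ (fun y => upd y i s) g).
  exact: continuous_upd.
exact: cg.
Qed.

Lemma continuous_bernop i N g : continuous g -> continuous (bernop i N g).
Proof.
move=> cg; apply: continuous_bern; first by move=> k; exact: continuous_updr.
exact: coord_continuous.
Qed.

Lemma Ck1_bernop i N g : Ck 1 g -> Ck 1 (bernop i N g).
Proof.
move=> g1; have [cg dg] := g1.
apply: (Ck_step 0 _ _ (continuous_bernop i N g cg)
  (fun j x => bernop_derive i N g j x g1)).
move=> j; case: (j == i); last by apply: continuous_bernop; have [] := dg j.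
apply: continuous_mul; first by move=> x; exact: cst_continuous.
apply: continuous_bern => [k x|]; last exact: coord_continuous.
by apply: continuousB; exact: continuous_updr.
Qed.

(** By the mean value theorem, each difference quotient in the i-th partial
derivative is a value of that derivative near a node, so all partial derivatives
are covered by [bern_sample]. *)
Lemma bernop_C1_near g i (eps : R) : Ck 1 g -> 0 < eps ->
  exists N, forall x, cube x ->
    `|bernop i N g x - g x| <= eps /\
    forall j, `|partial j (bernop i N g) x - partial j g x| <= eps.
Proof.
move=> g1 e0; have [cg dg] := g1.
have cdg j : continuous (partial j g) by have [] := dg j.
have [M0 M0P] := bern_sample g i eps cg e0.
have /choice[M MP] := fun j => bern_sample (partial j g) i eps (cdg j) e0.
(* the operator is used in degree N + 1 because its derivative has degree N *)
pose N := (M0 + \max_j M j).+1.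
have NM0 : (M0 < N)%N by rewrite ltnS leq_addr.
have NM j : (M j < N)%N by rewrite ltnS (leq_trans (leq_bigmax j))// leq_addl.
exists N.+1 => x xc; split.
  apply: (M0P _ _ _ (fun k => k%:R / N.+1%:R)) => //; first exact: ltnW.
  by move=> k kN; rewrite subrr normr0 invr_ge0 node01.
move=> j; rewrite (partialE (bernop_derive i N.+1 g j x g1)).
case: eqP => [->|_]; last first.
  apply: (MP j _ _ _ (fun k => k%:R / N.+1%:R)) => //; first exact: ltnW (NM j).
  by move=> k kN; rewrite subrr normr0 invr_ge0 node01.
have N0 : 0 < N.+1%:R :> R by rewrite ltr0n.
have N0' : 0 < N%:R :> R by rewrite ltr0n.
have /choice[xi xiP] : forall k : nat, exists s : R,
    k%:R / N.+1%:R <= s <= k.+1%:R / N.+1%:R /\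
    N.+1%:R * fdiff (fun k => g (upd x i (k%:R / N.+1%:R))) k = partial i g (upd x i s).
  move=> k.
  have kk : k%:R / N.+1%:R < k.+1%:R / N.+1%:R :> R.
    by rewrite ltr_pM2r ?invr_gt0// ltr_nat.
  have dgu t := Ck1_is_derive_upd g i x t g1.
  have [|s] := MVT kk (fun t _ => dgu t).
    by apply: derivable_within_continuous => t _; exact: (@ex_derive _ _ _ _ _ _ _ (dgu t)).
  rewrite in_itv /= => /andP[s1 s2] sE; exists s; split; first by rewrite !ltW.
  rewrite /fdiff sE -mulrBl -natrB// subSnn mulrC -mulrA mul1r mulVf ?mulr1//.
rewrite -[X in X * bern _ _ _](bern_cst N _ (x ord0 i)).
have -> : bern N (fun=> N.+1%:R) (x ord0 i) *
    bern N (fdiff (fun k => g (upd x i (k%:R / N.+1%:R)))) (x ord0 i) =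
  bern N (fun k => N.+1%:R * fdiff (fun k => g (upd x i (k%:R / N.+1%:R))) k) (x ord0 i).
  rewrite bern_cst -[LHS]addr0 -[X in _ + X](mul0r (bern N (fun=> 0) (x ord0 i))).
  by rewrite -bern_lin; apply: eq_bern => k; rewrite mul0r addr0.
apply: (MP i _ _ _ xi) => // k kN.
have [/andP[k1 k2] xiE] := xiP k.
have /andP[n1 _] : 0 <= (k%:R / N.+1%:R : R) <= 1 by apply: node01; rewrite leqW.
have /andP[_ n2] : 0 <= (k.+1%:R / N.+1%:R : R) <= 1 by exact: node01.
split => //; first by rewrite (le_trans n1 k1) (le_trans k2 n2).
(* both xi k and k / N lie in [k / (N + 1), (k + 1) / (N + 1)] *)
have h1 : k%:R / N.+1%:R <= k%:R / N%:R :> R.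
  by rewrite ler_wpM2l// lef_pV2 ?posrE// ler_nat.
have h2 : k%:R / N%:R <= k.+1%:R / N.+1%:R :> R.
  rewrite ler_pdivrMr// mulrAC ler_pdivlMr// -!natrM ler_nat.
  by rewrite [X in (X <= _)%N]mulnS mulSn leq_add2r.
have h3 : k.+1%:R / N.+1%:R = k%:R / N.+1%:R + N.+1%:R^-1 :> R.
  by rewrite -(natr1 k) mulrDl mul1r.
have h4 : N.+1%:R^-1 <= N%:R^-1 :> R by rewrite lef_pV2 ?posrE// ler_nat.
move: h1 h2 h3 h4 k1 k2; set a := k%:R / N%:R; set b := k%:R / N.+1%:R.
set d := _ / N.+1%:R; set u := N%:R^-1; set w := N.+1%:R^-1.
move: a b d u w => a b d u w *.
by rewrite ler_norml; apply/andP; split; lra.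
Qed.

(** Functions that are polynomial in the first i coordinates, with coefficients
that are functions of the others: for i = 0 this is every function, for i = n the
polynomials.  The inductive form makes stability under substitutions and under
Bernstein operators a structural recursion. *)
Inductive semipoly (i : nat) : ('rV[R]_n -> R) -> Prop :=
| semipoly_base h : (forall x y, (forall j, (i <= j)%N -> x ord0 j = y ord0 j) ->
    h x = h y) -> semipoly i h
| semipoly_coord (j : 'I_n) : (j < i)%N -> semipoly i (fun x => x ord0 j)
| semipoly_add h1 h2 : semipoly i h1 -> semipoly i h2 ->
    semipoly i (fun x => h1 x + h2 x)
| semipoly_mul h1 h2 : semipoly i h1 -> semipoly i h2 ->
    semipoly i (fun x => h1 x * h2 x).

Lemma semipoly_cst k (a : R) : semipoly k (fun=> a).
Proof. exact: semipoly_base. Qed.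

Lemma semipoly_upd i g (s : R) :
  semipoly i g -> semipoly i.+1 (fun x => g (upd x i s)).
Proof.
elim=> [h hP|j ji|h1 h2 _ H1 _ H2|h1 h2 _ H1 _ H2].
- apply: semipoly_base => x y xy; apply: hP => j ij; rewrite !updE.
  by case: eqVneq => // ji; apply: xy; rewrite ltn_neqAle ij andbT eq_sym.
- rewrite (_ : (fun _ => _) = fun x => x ord0 j).
    by apply: semipoly_coord; rewrite ltnS ltnW.
  by apply/funext => x; rewrite updE; case: eqP => // E; rewrite E ltnn in ji.
- exact: semipoly_add.
- exact: semipoly_mul.
Qed.

(** Freezing coordinate i turns coefficients into functions of the coordinates
above i, and the Bernstein weights are polynomial in coordinate i. *)
Lemma semipoly_bernop i N g : semipoly i g -> semipoly i.+1 (bernop i N g).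
Proof.
move=> gi; suff H (c : nat -> 'rV[R]_n -> R) : (forall k, semipoly i.+1 (c k)) ->
    semipoly i.+1 (fun x => bern N (c ^~ x) (x ord0 i)).
  by apply: (H (fun k x => g (upd x i (k%:R / N%:R)))) => k;
    exact: semipoly_upd.
elim: N c => [|N IH] c cP /=; first exact: cP.
have ci : semipoly i.+1 (fun x => x ord0 i) by exact: semipoly_coord.
apply: semipoly_add; apply: semipoly_mul; [|exact: IH|exact: ci|].
  have -> : (fun x : 'rV[R]_n => 1 - x ord0 i) = (fun x => 1 + -1 * x ord0 i).
    by apply/funext => x; rewrite mulN1r.
  by apply: semipoly_add; [|apply: semipoly_mul ci]; exact: semipoly_cst.
exact: (IH (c \o S) (fun k => cP k.+1)).
Qed.

(** The coordinates are treated one at a time, each step spending half of the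
error left. *)
Lemma polynomial_C1_dense f (eps : R) : Ck 1 f -> 0 < eps ->
  exists p, [/\ semipoly n p, Ck 1 p & forall x, cube x ->
    `|p x - f x| <= eps /\ forall j, `|partial j p x - partial j f x| <= eps].
Proof.
move=> f1.
suff H k : (k <= n)%N -> forall eps : R, 0 < eps ->
  exists p, [/\ semipoly k p, Ck 1 p & forall x, cube x ->
    `|p x - f x| <= eps /\ forall j, `|partial j p x - partial j f x| <= eps].
  exact: H.
elim: k => [_ e e0|k IH kn e e0].
  exists f; split=> // [|x _]; last by split=> [|j]; rewrite subrr normr0 ltW.
  apply: semipoly_base => x y xy; congr f; apply/rowP => j; exact: xy.
have e20 : 0 < e / 2 by rewrite divr_gt0.
have [p [pk p1 pf]] := IH (ltnW kn) _ e20.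
have [N Np] := bernop_C1_near p (Ordinal kn) _ p1 e20.
exists (bernop (Ordinal kn) N p); split; first exact: (semipoly_bernop (Ordinal kn)).
  exact: Ck1_bernop.
move=> x xc; have [pf0 pf1] := pf x xc; have [Np0 Np1] := Np x xc.
have tri (a b c : R) : `|a - b| <= e / 2 -> `|b - c| <= e / 2 -> `|a - c| <= e.
  by move=> ab bc; rewrite (le_trans (ler_distD b _ _))// [leRHS]splitr lerD.
by split=> [|j]; [exact: tri Np0 pf0|exact: tri (Np1 j) (pf1 j)].
Qed.

End cube_approximation.

(** * Smooth functions that are C^1-close on a large cube *)

Section smoothness.
Context {R : realType} {n : nat}.
Implicit Types (x y : 'rV[R]_n) (i j : 'I_n) (f g : 'rV[R]_n -> R).

Lemma Ck_add k f g : Ck k f -> Ck k g -> Ck k (fun x => f x + g x).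
Proof.
elim: k f g => [|k IH] f g fk gk; first exact: continuous_add.
apply: (Ck_step _ _ (fun i x => partial i f x + partial i g x)).
- by apply: continuous_add; [exact: Ck_continuous fk|exact: Ck_continuous gk].
- by move=> i x; apply: is_deriveD; apply: (Ck_is_derive k).
- by move=> i; apply: IH; [case: fk => _ /(_ i)[]|case: gk => _ /(_ i)[]].
Qed.

Lemma Ck_mul k f g : Ck k f -> Ck k g -> Ck k (fun x => f x * g x).
Proof.
elim: k f g => [|k IH] f g fk gk; first exact: continuous_mul.
apply: (Ck_step _ _ (fun i x => f x * partial i g x + g x * partial i f x)).
- by apply: continuous_mul; [exact: Ck_continuous fk|exact: Ck_continuous gk].
- by move=> i x; apply: is_deriveM; apply: (Ck_is_derive k).
- move=> i; apply: Ck_add; apply: IH; try exact: CkW.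
    by have [_ /(_ i)[]] := gk.
  by have [_ /(_ i)[]] := fk.
Qed.

Lemma smooth_add f g : smooth f -> smooth g -> smooth (fun x => f x + g x).
Proof. by move=> fs gs k; exact: Ck_add. Qed.

Lemma smooth_mul f g : smooth f -> smooth g -> smooth (fun x => f x * g x).
Proof. by move=> fs gs k; exact: Ck_mul. Qed.

Lemma smooth_cst (a : R) : smooth (fun _ : 'rV[R]_n => a).
Proof.
move=> k; elim: k a => [|k IH] a; first by move=> x; exact: cst_continuous.
apply: (Ck_step _ _ (fun _ _ => 0)) => // x; exact: cst_continuous.
Qed.

(** The span of the sine and the cosine is stable under differentiation. *)
Lemma smooth_trig (w a b : R) i :
  smooth (fun x => a * sin (w * x ord0 i) + b * cos (w * x ord0 i)).
Proof.
have cw : continuous (fun x : 'rV[R]_n => w * x ord0 i).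
  apply: continuous_mul; last exact: coord_continuous.
  by move=> x; exact: cst_continuous.
have cc (h : R -> R) : continuous h -> continuous (fun x : 'rV[R]_n => h (w * x ord0 i)).
  by move=> ch x; apply: continuous_comp; [exact: cw|exact: ch].
have c0 a' b' : continuous (fun x : 'rV[R]_n =>
    a' * sin (w * x ord0 i) + b' * cos (w * x ord0 i)).
  apply: continuous_add; apply: continuous_mul.
  - by move=> x; exact: cst_continuous.
  - by apply: cc; exact: continuous_sin.
  - by move=> x; exact: cst_continuous.
  - by apply: cc; exact: continuous_cos.
move=> k; elim: k a b => [|k IH] a b; first exact: c0.
apply: (Ck_step _ _ (fun j x => - b * w * (i == j)%:R * sin (w * x ord0 i)
   + a * w * (i == j)%:R * cos (w * x ord0 i))) => // j x.
apply/is_derive_upd; under eq_fun do rewrite updE.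
case: eqP => [->|_]; last first.
  by apply: is_derive_eq (is_derive_cst _ _ _) _; rewrite !mulr0 !mul0r addr0.
have dw : is_derive (x ord0 j) 1 (fun t : R => w * t) w.
  by apply: is_derive_eq; rewrite /GRing.scale /= mulr1.
have ds := is_derive1_comp (is_derive_sin (w * x ord0 j)) dw.
have dc := is_derive1_comp (is_derive_cos (w * x ord0 j)) dw.
apply: is_derive_eq (is_deriveD (is_deriveZ a ds) (is_deriveZ b dc)) _.
by rewrite /GRing.scale /=; ring.
Qed.

(** Maps the line into [0, 1]; with [unsquash] it gives the bounded substitute
sin (w t) / w for the identity. *)
Definition squash (w t : R) : R := (1 + sin (w * t)) / 2.
Definition unsquash (w u : R) : R := (2 * u - 1) / w.

Lemma squash01 (w t : R) : 0 <= squash w t <= 1.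
Proof.
have := sin_geN1 (w * t); have := sin_le1 (w * t); rewrite /squash => h1 h2.
by apply/andP; split; lra.
Qed.

Lemma squashK (w t : R) : unsquash w (squash w t) = sin (w * t) / w.
Proof. by rewrite /unsquash /squash; congr (_ / w); field. Qed.

Lemma is_derive_squash (w t : R) : is_derive t 1 (squash w) (cos (w * t) * w / 2).
Proof.
have dw : is_derive t 1 (fun t : R => w * t) w.
  by apply: is_derive_eq; rewrite /GRing.scale /= mulr1.
have ds := is_derive1_comp (is_derive_sin (w * t)) dw.
rewrite (_ : squash w = (1 / 2 : R) \*: (cst 1 + (sin \o (fun t => w * t)))).
  apply: is_derive_eq
    (is_deriveZ (1 / 2 : R) (is_deriveD (is_derive_cst (1 : R) t 1) ds)) _.
  by rewrite /GRing.scale /=; field.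
by apply/funext => u; rewrite /squash /GRing.scale /= mulrC mul1r.
Qed.

Lemma is_derive_unsquash (w u : R) : is_derive u 1 (unsquash w) (2 / w).
Proof.
rewrite (_ : unsquash w = (2 / w : R) \*: (id : R -> R) - cst (1 / w)).
  apply: is_derive_eq (is_deriveB (is_deriveZ (2 / w : R) (is_derive_id u (1 : R)))
    (is_derive_cst (1 / w : R) u 1)) _.
  by rewrite /GRing.scale /= subr0 mulr1.
apply/funext => v; rewrite /unsquash mulrBl mulrAC //.
Qed.

Lemma cvg_rV T (F : set_system T) {FF : Filter F} (u : T -> 'rV[R]_n) x :
  (forall i, (fun t => u t ord0 i) @ F --> x ord0 i) -> u @ F --> x.
Proof.
move=> ux; apply/cvg_ballP => e e0.
have : \forall t \near F, forall i, ball (x ord0 i) e (u t ord0 i).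
  by apply: filter_forall => i; move/cvg_ballP : (ux i); exact.
by apply: filterS => t H; split=> // i j; rewrite ord1.
Qed.

Lemma continuous_coordwise (s : R -> R) : continuous s ->
  continuous (@coordwise R n s).
Proof.
move=> cs x; apply: (@cvg_rV 'rV[R]_n (nbhs x) _ (coordwise s)) => i.
under eq_fun do rewrite mxE.
rewrite mxE; apply: (@continuous_comp _ _ _ (fun y : 'rV[R]_n => y ord0 i) s).
  exact: coord_continuous.
exact: cs.
Qed.

Lemma smooth_semipoly_squash (w : R) (p : 'rV[R]_n -> R) : semipoly n p ->
  smooth (p \o coordwise (squash w)).
Proof.
elim=> [h hP|j _|h1 h2 _ H1 _ H2|h1 h2 _ H1 _ H2].
- rewrite (_ : _ \o _ = (fun _ : 'rV[R]_n => h 0)); first exact: smooth_cst.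
  by apply/funext => x; apply: hP => j; rewrite leqNgt ltn_ord.
- rewrite (_ : _ \o _ = fun x : 'rV[R]_n => 1 / 2 +
     (1 / 2 * sin (w * x ord0 j) + 0 * cos (w * x ord0 j))).
    by apply: smooth_add; [exact: smooth_cst|exact: smooth_trig].
  by apply/funext => x /=; rewrite mxE /squash mul0r; lra.
- exact: smooth_add.
- exact: smooth_mul.
Qed.

Lemma continuous_of_is_derive (s ds : R -> R) :
  (forall t : R, is_derive t 1 s (ds t)) -> continuous s.
Proof.
move=> sds t; apply: differentiable_continuous; apply/derivable1_diffP.
exact: (@ex_derive _ _ _ _ _ _ _ (sds t)).
Qed.

(** g is p composed with squash, where p is a polynomial close on the cube to f
composed with unsquash.  The factor 2 / w in the gradient of the latter is undone
by the derivative of squash, up to the cosine. *)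
Lemma smooth_near_squashed f (w : R) : Ck 1 f -> 0 < w -> w <= 1 ->
  exists g, smooth g /\ forall x,
    let y := coordwise (fun t => sin (w * t) / w) x in
    `|g x - f y| <= w /\
    forall i, `|partial i g x - partial i f y * cos (w * x ord0 i)| <= w.
Proof.
move=> f1 w0 w1; have [cf df] := f1.
have cA := continuous_coordwise _ (continuous_of_is_derive _ _ (is_derive_unsquash w)).
have dfA i (u : 'rV[R]_n) :=
  is_derive_coordwise f _ _ i u f1 (is_derive_unsquash w (u ord0 i)).
have fA1 : Ck 1 (f \o coordwise (unsquash w)).
  apply: (Ck_step 0 _ _ _ dfA) => [u|i].
  - apply: (@continuous_comp _ _ _ (coordwise (unsquash w)) f); first exact: cA.
    exact: cf.
  - apply: continuous_mul; last by move=> u; exact: cst_continuous.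
    move=> u; apply: (@continuous_comp _ _ _ (coordwise (unsquash w)) (partial i f)).
      exact: cA.
    by have [_ c] := df i; exact: c.
have [p [ps p1 pf]] := polynomial_C1_dense _ _ fA1 w0.
exists (p \o coordwise (squash w)); split; first exact: smooth_semipoly_squash.
move=> x y.
have cx : cube (coordwise (squash w) x) by move=> i; rewrite mxE squash01.
have Ax : coordwise (unsquash w) (coordwise (squash w) x) = y.
  by apply/rowP => i; rewrite !mxE squashK.
have [p0 pd] := pf _ cx; split=> [|i]; first by move: p0; rewrite /= Ax.
rewrite (partialE (is_derive_coordwise p _ _ i x p1 (is_derive_squash w (x ord0 i)))).
move: (pd i); rewrite (partialE (dfA i _)) Ax.
set P := partial i p _; set D := partial i f y; set c := cos _ => PD.
have -> : P * (c * w / 2) - D * c = (P - D * (2 / w)) * (c * (w / 2)).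
  by field; rewrite gt_eqF.
rewrite normrM -[leRHS]mulr1; apply: ler_pM => //.
rewrite normrM -[leRHS]mulr1; apply: ler_pM => //.
  by rewrite ler_norml cos_geN1 cos_le1.
by rewrite gtr0_norm ?divr_gt0//; lra.
Qed.

(** The quotient is a difference quotient at 0 of h |-> sin (h t). *)
Lemma cvg_sinM_harmonic (t : R) :
  (fun k => sin (harmonic k * t) / harmonic k) @ \oo --> t.
Proof.
have dt : is_derive (0 : R) 1 (fun h : R => sin (h * t)) t.
  have dm : is_derive (0 : R) 1 (fun h : R => h * t) t.
    rewrite (_ : (fun h => _) = t \*: (id : R -> R)).
      by apply: is_derive_eq; rewrite /GRing.scale /= mulr1.
    by apply/funext => h; rewrite /GRing.scale /= mulrC.
  have ds := @is_derive1_comp R sin (fun h => h * t) 0 _ _ (is_derive_sin (0 * t)) dm.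
  apply: (is_derive_eq ds).
  by rewrite mul0r cos0 mul1r.
have cvg0 : (fun h : R => h^-1 * sin (h * t)) @ 0^'+ --> t.
  apply: cvg_dnbhs_at_right; case: dt => dt tE.
  rewrite -[X in _ --> X]tE (_ : (fun h : R => h^-1 * sin (h * t)) = fun h : R =>
      h^-1 *: (((fun h => sin (h * t)) \o shift 0) (h *: 1) - sin (0 * t))).
    exact: dt.
  by apply/funext => h; rewrite /= /GRing.scale /= mulr1 addr0 mul0r sin0 subr0.
under eq_fun do rewrite mulrC.
apply: ((cvg_at_rightP _ _ _).1 cvg0 (@harmonic R)).
by split=> [k|]; [exact: harmonic_gt0|exact: cvg_harmonic].
Qed.

End smoothness.

(** * Second moments and local means under a probability *)

Section bounded_measurable.
Context {d : measure_display} {T : measurableType d} {R : realType}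
  (mu : probability T R).
Implicit Types f g : T -> R.

Definition bounded_measurable f :=
  measurable_fun setT f /\ exists C : R, forall x, `|f x| <= C.

Lemma bounded_measurable_cst (a : R) : bounded_measurable (cst a).
Proof. by split; [exact: measurable_cst|exists `|a|]. Qed.

Lemma bounded_measurable_indic (A : set T) : measurable A ->
  bounded_measurable (\1_A : T -> R).
Proof.
move=> mA; split; first exact: measurable_indic.
by exists 1 => x; rewrite indicE; case: (x \in A); rewrite ?normr1 ?normr0.
Qed.

Lemma bounded_measurable_add f g : bounded_measurable f ->
  bounded_measurable g -> bounded_measurable (fun x => f x + g x).
Proof.
move=> [mf [C fC]] [mg [D gD]]; split; first exact: measurable_funD.
by exists (C + D) => x; apply: le_trans (ler_normD _ _) _; exact: lerD.
Qed.

Lemma bounded_measurable_mul f g : bounded_measurable f ->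
  bounded_measurable g -> bounded_measurable (fun x => f x * g x).
Proof.
move=> [mf [C fC]] [mg [D gD]]; split; first exact: measurable_funM.
by exists (C * D) => x; rewrite normrM; exact: ler_pM.
Qed.

Lemma bounded_measurable_integrable f (A : set T) : measurable A ->
  bounded_measurable f -> mu.-integrable A (EFin \o f).
Proof.
move=> mA [mf [C fC]]; apply: (integrableS measurableT) => //.
apply: measurable_bounded_integrable => //.
  by rewrite -ge0_fin_numE// fin_num_measure.
exists C; split=> [|M CM x _ /=]; first exact: num_real.
exact: le_trans (fC x) (ltW CM).
Qed.

Lemma EFin_Rintegral f (A : set T) : measurable A -> bounded_measurable f ->
  ((\int[mu]_(x in A) f x)%:E = \int[mu]_(x in A) (f x)%:E)%E.
Proof.
move=> mA bf; rewrite /Rintegral fineK//.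
exact/integrable_fin_num/bounded_measurable_integrable.
Qed.

Lemma bounded_RintegralD f g : bounded_measurable f -> bounded_measurable g ->
  \int[mu]_x (f x + g x) = \int[mu]_x f x + \int[mu]_x g x.
Proof. by move=> bf bg; apply: RintegralD => //; exact: bounded_measurable_integrable. Qed.

Lemma bounded_RintegralZ (a : R) f : bounded_measurable f ->
  \int[mu]_x (a * f x) = a * \int[mu]_x f x.
Proof. by move=> bf; apply: RintegralZl => //; exact: bounded_measurable_integrable. Qed.

Lemma probability_Rintegral_cst (a : R) : \int[mu]_x (cst a x) = a.
Proof.
rewrite Rintegral_cst// -[RHS]mulr1; congr (_ * _).
exact: (congr1 fine (probability_setT mu)).
Qed.

Lemma bounded_cvg_Rintegral (u : nat -> T -> R) f (C : R) :
  (forall k, measurable_fun setT (u k)) -> (forall k x, `|u k x| <= C) ->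
  measurable_fun setT f -> (forall x, u ^~ x @ \oo --> f x) ->
  (fun k => \int[mu]_x u k x) @ \oo --> \int[mu]_x f x.
Proof.
move=> mu_ uC mf uf.
have bu k : bounded_measurable (u k) by split=> //; exists C.
have fC x : `|f x| <= C.
  apply: (cvgr_to_le (cvg_norm (uf x))).
  by apply: nearW => k; exact: uC.
have bf : bounded_measurable f by split=> //; exists C.
have [] := @dominated_convergence d T R mu setT measurableT
  (fun k x => (u k x)%:E) (fun x => (f x)%:E) (cst C%:E).
- by move=> k; apply/measurable_EFinP.
- exact/measurable_EFinP.
- by apply/aeW => x _; apply: cvg_EFin; [exact: nearW|exact: uf].
- exact: (bounded_measurable_integrable (cst C) setT measurableT (bounded_measurable_cst C)).
- by apply/aeW => x k _; rewrite /= lee_fin.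
move=> _ _ H; apply: fine_cvg.
by rewrite -(EFin_Rintegral f) in H.
Qed.

Lemma variance_bounded f : bounded_measurable f ->
  'V_mu[f]%E = (\int[mu]_x (f x ^+ 2) - (\int[mu]_x f x) ^+ 2)%:E.
Proof.
move=> bf.
have Ef : fine 'E_mu[f]%E = \int[mu]_x f x by rewrite unlock.
rewrite /variance unlock Ef unlock /=; set m := \int[mu]_x f x.
have b2 := bounded_measurable_mul _ _ bf bf.
have bc := bounded_measurable_cst.
have bmf := bounded_measurable_mul _ _ (bc (- (2 * m))) bf.
have -> : (\int[mu]_w (((f \- cst m) * (f \- cst m))%R w)%:E =
    \int[mu]_w (f w * f w + (- (2 * m) * f w + m ^+ 2))%:E)%E.
  by apply: eq_integral => x _; congr EFin; rewrite /= -[LHS]/((f x - m) * (f x - m)); ring.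
have b3 := bounded_measurable_add _ _ bmf (bc (m ^+ 2)).
have b4 := bounded_measurable_add _ _ b2 b3.
rewrite -(EFin_Rintegral _ _ measurableT b4).
rewrite (bounded_RintegralD _ _ b2 b3) (bounded_RintegralD _ _ bmf (bc _)).
rewrite bounded_RintegralZ// probability_Rintegral_cst -/m; congr EFin.
have -> : \int[mu]_x (f x ^+ 2) = \int[mu]_x (f x * f x) by [].
ring.
Qed.

(** A function with zero integral over B needs a large second moment to have
a large mean: expand the square of f - m 1_B', where m is the mean of f and B'
the complement of B. *)
Lemma second_moment_local_mean f (B : set T) : measurable B ->
  bounded_measurable f -> \int[mu]_(x in B) f x = 0 ->
  (\int[mu]_x f x) ^+ 2 * (1 + fine (mu B)) <= \int[mu]_x (f x ^+ 2).
Proof.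
move=> mB bf fB; set m := \int[mu]_x f x; set b := fine (mu B).
have bB := bounded_measurable_indic B mB.
have bc := bounded_measurable_cst.
have IB : \int[mu]_x (\1_B x : R) = b.
  rewrite /b; have := Rintegral_cst mu mB 1; rewrite mul1r => <-.
  rewrite [RHS]Rintegral_mkcond; apply: eq_Rintegral => x _.
  by rewrite patch_indic /= mul1r.
have IfB : \int[mu]_x (f x * \1_B x) = 0.
  rewrite -fB [RHS]Rintegral_mkcond.
  by apply: eq_Rintegral => x _; rewrite patch_indic.
have b2 := bounded_measurable_mul _ _ bf bf.
have bfB := bounded_measurable_mul _ _ bf bB.
have : 0 <= \int[mu]_x ((f x - m * (1 - \1_B x)) ^+ 2).
  by apply: Rintegral_ge0 => x _; exact: sqr_ge0.
have -> : \int[mu]_x ((f x - m * (1 - \1_B x)) ^+ 2) =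
    \int[mu]_x (f x * f x + (-(2 * m) * f x +
       (2 * m * (f x * \1_B x) + (m ^+ 2 + - m ^+ 2 * \1_B x)))).
  apply: eq_Rintegral => x _.
  have : (\1_B x : R) * \1_B x = \1_B x.
    by rewrite indicE; case: (x \in B); rewrite ?mulr0 ?mulr1.
  move: (\1_B x : R) => i i2.
  have E : m ^+ 2 * (i * i - i) = 0 by rewrite i2 subrr mulr0.
  by rewrite -[RHS]addr0 -E; ring.
have t4 := bounded_measurable_mul _ _ (bc (- m ^+ 2)) bB.
have t34 := bounded_measurable_add _ _ (bc (m ^+ 2)) t4.
have t2 := bounded_measurable_mul _ _ (bc (2 * m)) bfB.
have t234 := bounded_measurable_add _ _ t2 t34.
have t1 := bounded_measurable_mul _ _ (bc (- (2 * m))) bf.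
have t1234 := bounded_measurable_add _ _ t1 t234.
rewrite (bounded_RintegralD _ _ b2 t1234) (bounded_RintegralD _ _ t1 t234).
rewrite (bounded_RintegralD _ _ t2 t34) (bounded_RintegralD _ _ (bc _) t4).
rewrite (bounded_RintegralZ _ _ bf) (bounded_RintegralZ _ _ bfB).
rewrite (bounded_RintegralZ _ _ bB) IfB IB -/m probability_Rintegral_cst.
rewrite -[\int[mu]_x (f x * f x)]/(\int[mu]_x (f x ^+ 2)).
lra.
Qed.

Lemma second_moment_le_variance f (B : set T) : measurable B ->
  bounded_measurable f -> \int[mu]_(x in B) f x = 0 -> 0 < fine (mu B) ->
  \int[mu]_x (f x ^+ 2) <=
    2 / fine (mu B) * (\int[mu]_x (f x ^+ 2) - (\int[mu]_x f x) ^+ 2).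
Proof.
move=> mB bf fB b0; have := second_moment_local_mean f B mB bf fB.
have b1 : fine (mu B) <= 1.
  by rewrite -lee_fin fineK ?fin_num_measure// probability_le1.
set b := fine _ in b0 b1 *; set S := \int[mu]_x (f x ^+ 2).
set q := (\int[mu]_x f x) ^+ 2 => H.
have q0 : 0 <= q by exact: sqr_ge0.
have v0 : 0 <= S - q by have := mulr_ge0 q0 (ltW b0); lra.
have b1' : 0 <= 1 - b by rewrite subr_ge0.
by rewrite mulrAC ler_pdivlMr//; have := mulr_ge0 v0 b1'; lra.
Qed.

End bounded_measurable.

(** * The Poincare inequality for bounded C^1 functions *)

Section poincare_Cb1.
Context {R : realType} {n : nat}.
Implicit Types (x y : 'rV[R]_n) (i j : 'I_n) (f g : 'rV[R]_n -> R).

Lemma cvg_dist_harmonic (u v : nat -> R) (l : R) :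
  (forall k, `|u k - v k| <= harmonic k) -> v @ \oo --> l -> u @ \oo --> l.
Proof.
move=> uv vl; have d0 : (fun k => u k - v k) @ \oo --> (0 : R).
  apply: norm_cvg0; apply: (squeeze_cvgr _ (cvg_cst (0 : R)) cvg_harmonic).
  by apply: nearW => k; rewrite normr_ge0 uv.
rewrite -[l]addr0 (_ : u = fun k => v k + (u k - v k)); first exact: cvgD.
by apply/funext => k; rewrite subrKC.
Qed.

(** Convergence is only pointwise, since f need not be uniformly continuous; the
common bounds make it sufficient for dominated convergence. *)
Lemma smooth_approximation f (C : R) : Ck 1 f ->
  (forall x, `|f x| <= C) -> (forall i x, `|partial i f x| <= C) ->
  exists g : nat -> 'rV[R]_n -> R,
  [/\ forall k, smooth (g k),
      forall k x, `|g k x| <= C + 1,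
      forall k i x, `|partial i (g k) x| <= C + 1,
      forall x, g ^~ x @ \oo --> f x &
      forall i x, (fun k => partial i (g k) x) @ \oo --> partial i f x].
Proof.
move=> f1 fC dfC; have [cf df] := f1.
have h1 k : harmonic k <= 1 :> R by rewrite invf_le1 ?ler1n ?ltr0n.
have /choice[g gP] := fun k =>
  smooth_near_squashed f (harmonic k) f1 (harmonic_gt0 k) (h1 k).
pose y k x := coordwise (fun t => sin (harmonic k * t) / harmonic k) x : 'rV[R]_n.
have yx x : y ^~ x @ \oo --> x.
  apply: cvg_rV => i; under eq_fun do rewrite mxE; exact: cvg_sinM_harmonic.
have tri (a b : R) (k : nat) : `|a - b| <= harmonic k -> `|b| <= C -> `|a| <= C + 1.
  move=> ab bC; rewrite -[a](subrK b) addrC; apply: le_trans (ler_normD _ _) _.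
  by apply: lerD => //; exact: le_trans ab (h1 k).
have cosC k i x : `|partial i f (y k x) * cos (harmonic k * x ord0 i)| <= C.
  rewrite normrM -[leRHS]mulr1; apply: ler_pM => //.
  by rewrite ler_norml cos_geN1 cos_le1.
exists g; split=> [k|k x|k i x|x|i x].
- by have [] := gP k.
- by have [_ /(_ x)[H _]] := gP k; exact: tri H (fC _).
- by have [_ /(_ x)[_ /(_ i) H]] := gP k; exact: tri H (cosC _ _ _).
- apply: (@cvg_dist_harmonic _ (fun k => f (y k x))) => [k|].
    by have [_ /(_ x)[]] := gP k.
  exact: (cvg_comp (fun k => y k x) f (yx x) (cf x)).
- apply: (@cvg_dist_harmonic _
    (fun k => partial i f (y k x) * cos (harmonic k * x ord0 i))) => [k|].
    by have [_ /(_ x)[_ /(_ i)]] := gP k.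
  rewrite -[X in _ --> X]mulr1; apply: cvgM.
    have [_ cdf] := df i.
    exact: (cvg_comp (fun k => y k x) (partial i f) (yx x) (cdf x)).
  rewrite -cos0 -(mul0r (x ord0 i)).
  apply: (cvg_comp (fun k => harmonic k * x ord0 i) cos); last exact: continuous_cos.
  by apply: cvgM; [exact: cvg_harmonic|exact: cvg_cst].
Qed.

Lemma continuous_measurable_rV f : continuous f -> measurable_fun setT f.
Proof.
move=> cf; apply: (measurability _ (RGenOInfty.measurableE R)).
move=> _ [_ [a ->] <-]; rewrite setTI; apply: open_measurable_mx.
by apply: open_comp; [move=> x _; exact: cf|exact: interval_open].
Qed.

Lemma Cb1_bound f : Cb1 f -> exists C : R,
  (forall x, `|f x| <= C) /\ (forall i x, `|partial i f x| <= C).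
Proof.
have bnd g : bounded_fun g -> exists C : R, forall x, `|g x| <= C.
  move=> /pinfty_ex_gt0[C _ gC]; exists C => x; exact: gC.
move=> [_ /bnd[C fC] bdf].
have /choice[D fD] i := bnd _ (bdf i).
exists (`|C| + \sum_i `|D i|); split=> [x|i x].
  rewrite (le_trans (fC x))// (le_trans (ler_norm _))// lerDl.
  by apply: sumr_ge0.
rewrite (le_trans (fD i x))// (le_trans (ler_norm _))//.
by rewrite (bigD1 i)//= addrCA lerDl addr_ge0// sumr_ge0.
Qed.

Lemma sqnorm_gradE f x : sqnorm (grad f x) = \sum_i partial i f x ^+ 2.
Proof. by apply: eq_bigr => i _; rewrite mxE. Qed.

Lemma bounded_measurable_sqnorm_grad f (C : R) : Ck 1 f ->
  (forall i x, `|partial i f x| <= C) ->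
  measurable_fun setT (fun x => sqnorm (grad f x)) /\
  forall x, `|sqnorm (grad f x)| <= \sum_(i < n) C ^+ 2.
Proof.
move=> [cf df] dfC; split=> [|x].
  under eq_fun do rewrite sqnorm_gradE.
  apply: measurable_sum => i; apply: measurable_funX.
  by apply: continuous_measurable_rV; have [] := df i.
rewrite sqnorm_gradE ger0_norm; last by apply: sumr_ge0 => i _; exact: sqr_ge0.
apply: ler_sum => i _; rewrite -real_normK ?num_real// ler_sqr ?nnegrE//.
exact: le_trans (normr_ge0 _) (dfC i x).
Qed.

Lemma poincare_Cb1 (mu : probability 'rV[R]_n R) (CP : R) f :
  poincare mu CP -> Cb1 f ->
  \int[mu]_x (f x ^+ 2) - (\int[mu]_x f x) ^+ 2 <=
    CP * \int[mu]_x (sqnorm (grad f x)).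
Proof.
move=> hCP fb; have [f1 _ _] := fb; have [C [fC dfC]] := Cb1_bound f fb.
have [g [gs gC dgC gf dgf]] := smooth_approximation f C f1 fC dfC.
have cg k : continuous (g k) by have [] := gs k 1%N.
have mg k := continuous_measurable_rV _ (cg k).
have mf := continuous_measurable_rV _ (proj1 f1).
have [mgf _] := bounded_measurable_sqnorm_grad f C f1 dfC.
have mgg k := bounded_measurable_sqnorm_grad (g k) (C + 1) (gs k 1%N) (dgC k).
have E1 := bounded_cvg_Rintegral mu g f (C + 1) mg gC mf gf.
have E2 : (fun k => \int[mu]_x (g k x ^+ 2)) @ \oo --> \int[mu]_x (f x ^+ 2).
  apply: (bounded_cvg_Rintegral mu (fun k x => g k x ^+ 2) _ ((C + 1) ^+ 2)).
  - by move=> k; exact: measurable_funX.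
  - move=> k x; rewrite normrX ler_sqr ?nnegrE//.
    exact: le_trans (normr_ge0 _) (gC k x).
  - exact: measurable_funX.
  - by move=> x; apply: cvgM; exact: gf.
have E3 : (fun k => \int[mu]_x (sqnorm (grad (g k) x))) @ \oo -->
    \int[mu]_x (sqnorm (grad f x)).
  apply: (bounded_cvg_Rintegral mu _ _ (\sum_(i < n) (C + 1) ^+ 2)) => //.
  - by move=> k; have [] := mgg k.
  - by move=> k x; have [_] := mgg k; exact.
  - move=> x; rewrite sqnorm_gradE; under eq_fun do rewrite sqnorm_gradE.
    by apply: cvg_big => [|i _]; [exact: add_continuous|apply: cvgM; exact: dgf].
have L : (fun k => \int[mu]_x (g k x ^+ 2) - (\int[mu]_x g k x) ^+ 2) @ \oo -->
    \int[mu]_x (f x ^+ 2) - (\int[mu]_x f x) ^+ 2.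
  by apply: cvgB E2 _; apply: cvgM.
have U : (fun k => CP * \int[mu]_x (sqnorm (grad (g k) x))) @ \oo -->
    CP * \int[mu]_x (sqnorm (grad f x)).
  by apply: cvgM => //; exact: cvg_cst.
apply: (ler_cvg_to L U); apply: nearW => k.
have bg : bounded_measurable (g k) by split=> //; exists (C + 1) => x; exact: gC.
have bgg : bounded_measurable (fun x => sqnorm (grad (g k) x)).
  by have [m b] := mgg k; split=> //; exists (\sum_(i < n) (C + 1) ^+ 2).
have := hCP _ (gs k); rewrite variance_bounded//.
by rewrite -EFin_Rintegral// -EFinM lee_fin.
Qed.

End poincare_Cb1.

(** * Euclidean balls have positive mass *)

Section balls.
Context {R : realType} {n : nat}.

Lemma eball_sqr (a : 'rV[R]_n) (r : R) : 0 < r ->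
  eball a r = [set x | sqnorm (x - a) < r ^+ 2].
Proof.
move=> r0; have E (s : R) : (Num.sqrt s < r) = (s < r ^+ 2).
  by rewrite -[X in _ < X](gtr0_norm r0) -sqrtr_sqr ltr_sqrt// exprn_gt0.
by apply/seteqP; split=> x; rewrite /eball /= E.
Qed.

Lemma measurable_eball (a : 'rV[R]_n) (r : R) : 0 < r -> measurable (eball a r).
Proof.
move=> r0; rewrite eball_sqr//.
have ms : measurable_fun setT (fun x : 'rV[R]_n => sqnorm (x - a)).
  apply: measurable_sum => i; apply: measurable_funX.
  under eq_fun do rewrite mxE.
  by apply: measurable_funD; [exact: measurable_coord|exact: measurable_cst].
have := ms measurableT _ (measurable_itv `]-oo, r ^+ 2[); rewrite setTI.
by congr (measurable _); apply/seteqP; split=> x /=; rewrite in_itv.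
Qed.

(** The ball contains the box of half-side r / (n + 1). *)
Lemma lebesgue_eball_gt0 (a : 'rV[R]_n) (r : R) : 0 < r ->
  (0 < lebesgue_rV R n (eball a r))%E.
Proof.
move=> r0; have [s s0 rE] : exists2 s : R, 0 < s & r = n.+1%:R * s.
  by exists (r / n.+1%:R); rewrite ?divr_gt0// mulrC divfK.
pose l i := a ord0 i - s; pose u i := a ord0 i + s.
pose Q := [set x : 'rV[R]_n | forall i, l i <= x ord0 i <= u i].
have Q0 : (0 < lebesgue_rV R n Q)%E.
  rewrite lebesgue_rV_box => [|i]; last by rewrite /l /u; lra.
  by rewrite lte_fin; apply: prodr_gt0 => i _; rewrite /l /u; lra.
have mQ : measurable Q.
  rewrite (_ : Q = \bigcap_(i in [set: 'I_n])
      ((fun x : 'rV[R]_n => x ord0 i) @^-1` `[l i, u i])).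
    apply: fin_bigcap_measurable => // i _.
    by rewrite -[X in measurable X]setTI; exact: measurable_coord.
  by apply/seteqP; split=> x /= H i => [_|]; have := H i;
    rewrite /= in_itv/= => // /(_ Logic.I).
apply: (lt_le_trans Q0); apply: le_measure; rewrite ?inE//.
  exact: measurable_eball.
move=> x /= xb; rewrite eball_sqr//=.
apply: (@le_lt_trans _ _ (\sum_(i < n) s ^+ 2)).
  apply: ler_sum => i _; rewrite !mxE.
  rewrite -real_normK ?num_real// ler_sqr ?nnegrE// ?(ltW s0)//.
  have := xb i; rewrite /l /u => /andP[h1 h2].
  by rewrite ler_norml; apply/andP; split; lra.
rewrite rE sumr_const card_ord exprMn -[_ *+ n]mulr_natl ltr_pM2r ?exprn_gt0//.
by rewrite -natrX ltr_nat (leq_trans (ltnSn n))// leq_pmulr.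
Qed.

(** A positive function cannot integrate to 0 over a set of positive Lebesgue
measure. *)
Lemma density_eball_gt0 (mu : set 'rV[R]_n -> \bar R) (V : 'rV[R]_n -> \bar R)
    (a : 'rV[R]_n) (r : R) : has_potential mu V -> 0 < r ->
  (forall x, eball a r x -> V x \is a fin_num) -> (0 < mu (eball a r))%E.
Proof.
move=> [mV muV] r0 Vfin; have mB := measurable_eball a r r0.
pose h x : \bar R := (expR (- fine (V x)))%:E.
have -> : mu (eball a r) = (\int[lebesgue_rV R n]_(x in eball a r) h x)%E.
  by rewrite muV//; apply: eq_integral => x /[!inE] /Vfin Vx; rewrite /h -{1}(fineK Vx).
have h0 x : (0 <= h x)%E by rewrite lee_fin expR_ge0.
have mh : measurable_fun (eball a r) h.
  apply/measurable_EFinP; apply: measurableT_comp; first exact: measurable_expR.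
  apply: measurable_funN; apply: (measurable_funS measurableT) => //.
  by apply: measurableT_comp mV; exact: fine_measurable.
rewrite lt0e integral_ge0// andbT; apply/negP => /eqP I0.
have /ae_eq_integral_abs : (\int[lebesgue_rV R n]_(x in eball a r) `|h x| = 0)%E.
  by rewrite -[RHS]I0; apply: eq_integral => x _; rewrite gee0_abs.
move=> /(_ mB mh) ae0.
have : (lebesgue_rV R n).-negligible (eball a r).
  apply: negligibleS ae0 => x Bx /= /(_ Bx) [hx].
  by have := expR_gt0 (- fine (V x)); rewrite hx ltxx.
move=> /(negligibleP _ mB) B0; have := lebesgue_eball_gt0 a r r0.
by rewrite B0 ltxx.
Qed.

End balls.

(** * The local-to-global inequality *)

Theorem theorem3p7 (R : realType) :
  exists kappa : R,
  forall (n : nat) (hn : (1 <= n)%N)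
    (mu : probability 'rV[R]_n R) (V : 'rV[R]_n -> \bar R)
    (hV : forall x, V x != -oo%E) (hmu : has_potential mu V)
    (CP : R) (hCP : poincare mu CP)
    (a : 'rV[R]_n) (r : R) (hr : 0 < r)
    (happrox : exists (Vk : nat -> 'rV[R]_n -> R)
        (muk : nat -> {measure set 'rV[R]_n -> \bar R}),
      [/\ forall k, smooth (Vk k),
          forall k, has_potential (muk k) (fun x => (Vk k x)%:E),
          weak_cvg muk mu &
          unif_cvg_on (eball a (2 * r)) Vk V])
    (f : 'rV[R]_n -> R) (hf : Cb1 f)
    (hf0 : (\int[mu]_(x in eball a (2 * r)) (f x)%:E = 0)%E),
  let eOsc := expR (fine (osc (eball a (2 * r)) V)) in
  (\int[mu]_x (f x ^+ 2)%:E <=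
   (32 * CP / fine (mu (eball a r)) * (1 + 2 * (kappa * eOsc / n%:R))
    + 2 * (kappa * r ^+ 2 * eOsc / n%:R))%:E
   * \int[mu]_x (sqnorm (grad f x))%:E)%E.
Proof.
exists 0 => n _ mu V _ hmu CP hCP a r r0 [Vk [muk [_ _ _ VkV]]] f hf hf0; cbv zeta.
have r20 : 0 < 2 * r by rewrite mulr_gt0.
have mB1 := measurable_eball a r r0; have mB2 := measurable_eball a _ r20.
have B12 : eball a r `<=` eball a (2 * r).
  by move=> x /lt_trans; apply; rewrite ltr_pMl// ltr1n.
have Vfin x : eball a (2 * r) x -> V x \is a fin_num.
  move=> Bx; have [k _ /(_ k (leqnn k)) /(_ x Bx)] := VkV 1 ltr01.
  by case: (V x) => //.
have muB1 : (0 < mu (eball a r))%E.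
  by apply: density_eball_gt0 hmu r0 _ => x /B12; exact: Vfin.
have b1_gt0 : 0 < fine (mu (eball a r)).
  by rewrite fine_gt0// muB1 -ge0_fin_numE// fin_num_measure.
have b12 : fine (mu (eball a r)) <= fine (mu (eball a (2 * r))).
  by rewrite fine_le ?fin_num_measure//; apply: le_measure; rewrite ?inE.
have b2_gt0 := lt_le_trans b1_gt0 b12.
have [C [fC dfC]] := Cb1_bound f hf; have [f1 _ _] := hf.
have bf : bounded_measurable f.
  by split; [exact: (continuous_measurable_rV _ (proj1 f1))|exists C].
have bff := bounded_measurable_mul _ _ bf bf.
have bgf : bounded_measurable (fun x => sqnorm (grad f x)).
  have [m b] := bounded_measurable_sqnorm_grad f C f1 dfC.
  by split=> //; exists (\sum_(i < n) C ^+ 2).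
have fB0 : \int[mu]_(x in eball a (2 * r)) f x = 0 by rewrite /Rintegral hf0.
have S2 := second_moment_le_variance mu f _ mB2 bf fB0 b2_gt0.
have var := poincare_Cb1 mu CP f hCP hf.
rewrite -(EFin_Rintegral mu _ _ measurableT bff) -(EFin_Rintegral mu _ _ measurableT bgf).
rewrite -EFinM lee_fin !mul0r mulr0 !addr0 mulr1.
set G := \int[mu]_x sqnorm _ in var *.
set v := _ - _ in S2 var.
have v0 : 0 <= v.
  rewrite -(pmulr_rge0 _ (divr_gt0 (ltr0n R 2) b2_gt0)) (le_trans _ S2)//.
  by apply: Rintegral_ge0 => x _; exact: sqr_ge0.
apply: (le_trans S2).
apply: (@le_trans _ _ (32 / fine (mu (eball a r)) * v)).
  apply: ler_wpM2r => //; apply: ler_pM; rewrite ?invr_ge0 ?ler_nat//; first exact: ltW.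
  by rewrite lef_pV2.
rewrite (_ : 32 * CP / _ * G = 32 / fine (mu (eball a r)) * (CP * G)); last by ring.
by apply: ler_wpM2l => //; rewrite divr_ge0// ltW.
Qed.
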